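(* For every integer $d \geq 3$, the set $\mathcal{G}_d$ (the generalised Rauzy gasket in the standard $(d-1)$-dimensional simplex of $\mathbb{R}^d$) satisfies $\dim_H(\mathcal{G}_d) < d-1$, where $\dim_H$ denotes Hausdorff dimension.
   Context: Let $d \geq 3$ be an integer. Let $\Delta = \{x \in [0,1]^d : \|x\| = 1\} \subset \mathbb{R}^d$ be the standard $(d-1)$-simplex, where $\|x\| = \sum_{j=1}^d |x_j|$ is the $\ell^1$ norm. For $j \in \{1,\ldots,d\}$ let $M_j \in \{0,1\}^{d\times d}$ be the matrix with $(M_j)_{i,k} = 1$ if $i=j$ or $i=k$, and $(M_j)_{i,k}=0$ otherwise (ones on the main diagonal and on the $j$th row, zeros elsewhere). Define $T_j : \Delta \to \Delta$ by $T_j(x) = \dfrac{M_j x}{\|M_j x\|}$. The set $\mathcal{G}_d$ is the attractor of $\{T_j\}_{j=1}^d$, i.e. the unique non-empty compact subset of $\Delta$ such that $\mathcal{G}_d = \bigcup_{j=1}^d T_j(\mathcal{G}_d)$. (For $d=3$, $\mathcal{G}_3$ is the Rauzy gasket.) Hausdorff dimension is taken with respect to the Euclidean metric. *)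

(* Defs.v *)
From HB Require Import structures.
From mathcomp Require Import all_boot all_order all_algebra.
From mathcomp Require Import all_classical all_reals all_analysis.

Set Implicit Arguments.
Unset Strict Implicit.
Unset Printing Implicit Defensive.

Import Order.TTheory GRing.Theory Num.Theory.
Import numFieldNormedType.Exports.

Local Open Scope classical_set_scope.
Local Open Scope ring_scope.

Section Hausdorff.
Context {R : realType} {X : Type}.
Variable dist : X -> X -> R.

Definition diam (U : set X) : \bar R :=
  ereal_sup [set (dist x y)%:E | x in U & y in U].

(* Empty sets are left out of the sum, so that they contribute 0 also when
   s = 0, where [poweR] gives every nonempty set the weight 1. Finite covers are
   the covers that are eventually empty. *)
Definition hausdorff_premeasure (s delta : R) (A : set X) : \bar R :=
  ereal_inf [set (\sum_(0 <= k <oo | U k != set0) (diam (U k) `^ s)%E)%E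
            | U in [set U : nat -> set X |
                A `<=` \bigcup_k U k /\
                forall k, (diam (U k) <= delta%:E)%E]].

Definition hausdorff_measure (s : R) (A : set X) : \bar R :=
  ereal_sup [set hausdorff_premeasure s delta A | delta in [set x | 0 < x]].

Definition hausdorff_dim (A : set X) : \bar R :=
  ereal_inf [set s%:E | s in [set s : R | 0 <= s /\ hausdorff_measure s A = 0%E]].

End Hausdorff.

Section Gasket.
Context {R : realType} {d : nat}.
Implicit Types (x y : 'cV[R]_d) (j : 'I_d) (G : set 'cV[R]_d).

Definition euclid_dist x y : R := Num.sqrt (\sum_i (x i 0 - y i 0) ^+ 2).

(* The library's norm on matrices is the sup norm. *)
Definition l1norm x : R := \sum_i `|x i 0|.

Definition simplex : set 'cV[R]_d :=
  [set x : 'cV[R]_d | (forall i, 0 <= x i 0 <= 1) /\ l1norm x = 1].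

Definition gasket_mx j : 'M[R]_d :=
  \matrix_(i, k) ((i == j) || (i == k))%:R.

Definition gasket_map j x : 'cV[R]_d :=
  (l1norm (gasket_mx j *m x))^-1 *: (gasket_mx j *m x).

(* These properties determine G; its uniqueness is not built into the predicate. *)
Definition is_gasket G : Prop :=
  [/\ G !=set0, compact G, G `<=` simplex &
      G = \bigcup_j (gasket_map j @` G)].

End Gasket.

(* Main.v *)
(* For a word w in the letters 1, ..., d let c be the vector of column sums of the product
   M_w, and P the product of its entries; the cylinder T_w(Delta) has volume
   proportional to 1/P. Appending a letter j adds c_j to all the other entries of c.

   Dynamics. Every c in the orbit of (1, ..., 1) satisfies (d - 1) c_m < c_1 + ... + c_d,
   whence c_m <= c_a + c_b for all a != b: apart from the smallest one, the entries
   are comparable, and all of them are comparable when the last letter has just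
   changed. Then a fixed proportion of the volume is lost at the next step. Regrouping
   words into blocks j ... j k (k != j), whose volumes decrease like a power of the
   length >= 3, this loss survives when the exponent 1 is lowered slightly: the sum of
   P^-(1 - e) over all words converges for some e > 0, so that its restriction to the
   words of length n takes arbitrarily small values.

   Geometry. M_w being unimodular, counting the integer points of the cone it spans
   shows that T_w(Delta) is covered by O(P^(d - 2)) sets of diameter O(1/P). The
   contribution of T_w(Delta) to the measure of dimension d - 1 - e is therefore
   O(P^-(1 - e)). *)
Require Import Defs.
From mathcomp Require Import all_boot all_order all_algebra.
From mathcomp Require Import all_classical all_reals all_analysis.
From mathcomp Require Import ring lra zify.

Set Implicit Arguments.
Unset Strict Implicit.
Unset Printing Implicit Defensive.

Import Order.TTheory GRing.Theory Num.Theory.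

Local Open Scope classical_set_scope.
Local Open Scope ring_scope.

(* If [k] beats [i] with probability [p k i], in independent matches between the
   players of [s], this is the probability that some player beats all the others. *)
Definition sum_prod_others {R : comPzSemiRingType} {T : eqType}
    (p : T -> T -> R) (s : seq T) : R :=
  \sum_(k <- s) \prod_(i <- s | i != k) p k i.

Lemma sum_prod_others_cons {R : comPzSemiRingType} {T : eqType}
    (p : T -> T -> R) a (s : seq T) : a \notin s ->
  sum_prod_others p (a :: s) = \prod_(i <- s) p a i
    + \sum_(k <- s) p k a * \prod_(i <- s | i != k) p k i.
Proof.
move=> as_; rewrite /sum_prod_others big_cons big_cons eqxx /=; congr (_ + _).
  rewrite big_seq_cond [RHS]big_seq; apply: eq_bigl => i.
  by case: (boolP (i \in s)) => //= is_; apply: contraNneq as_ => <-.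
rewrite big_seq [RHS]big_seq; apply: eq_bigr => k ks.
by rewrite big_cons ifT //; apply: contraNneq as_ => ->.
Qed.

(** The left side consists of the terms of degree at most 1 in [x] of the expanded product. *)
Lemma ler_prodD {R : numDomainType} {T : eqType} (c : T -> R) (x : R) (s : seq T) :
  (forall i, 0 <= c i) -> 0 <= x -> uniq s ->
  \prod_(i <- s) c i + x * sum_prod_others (fun=> c) s <= \prod_(i <- s) (c i + x).
Proof.
move=> c0 x0; elim: s => [|a s IH] /=.
  by rewrite /sum_prod_others !big_nil mulr0 addr0.
case/andP=> as_ /IH {}IH; rewrite sum_prod_others_cons // !big_cons.
apply: le_trans (ler_wpM2l (addr_ge0 (c0 a) x0) IH).
rewrite -mulr_sumr -/(sum_prod_others (fun=> c) s).
set u := \prod_(i <- s) _; set v := sum_prod_others _ _.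
have v0 : 0 <= v.
  by apply: sumr_ge0 => k _; apply: prodr_ge0.
have -> : (c a + x) * (u + x * v) = c a * u + x * (u + c a * v) + x * (x * v).
  by ring.
by rewrite lerDl !mulr_ge0.
Qed.

(** * Chances of an undefeated player *)

Section Tournament.
Context {R : realFieldType} {T : eqType}.
Variable p : T -> T -> R.

Hypothesis p_gt0 : forall i k, 0 < p i k.
Hypothesis p_compl : forall i k, i != k -> p i k + p k i = 1.

(** A winner from [s] must also beat the newcomer [a], which costs a factor at most [p m a], where
    [m] is the strongest player against [a]. The newcomer itself wins with probability
    [p a m = 1 - p m a] times the product of its other chances. *)
Lemma sum_prod_others_argmax a (s : seq T) : a \notin s -> s != [::] -> sum_prod_others p s <= 1 ->
  exists2 m, m \in s & sum_prod_others p (a :: s) <=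
    p m a + (1 - p m a) * \prod_(i <- rem m s) p a i.
Proof.
move=> as_ s0 W1.
have [m ms mmax] : exists2 m, m \in s & forall i, i \in s -> p i a <= p m a.
  elim: s s0 {as_ W1} => // b [|b' s] IH _.
    by exists b; rewrite ?mem_head // => i; rewrite inE => /eqP->.
  have [m ms mmax] := IH isT.
  have [le|/ltW le] := leP (p b a) (p m a).
    exists m; first by rewrite inE ms orbT.
    by move=> i; rewrite inE => /predU1P[->//|]; exact: mmax.
  exists b; first exact: mem_head.
  move=> i; rewrite inE => /predU1P[->//|/mmax h]; exact: le_trans h le.
exists m => //; rewrite sum_prod_others_cons // addrC; apply: lerD.
  apply: (@le_trans _ _ (p m a * sum_prod_others p s)); last first.
    by rewrite ler_piMr // ltW.
  rewrite /sum_prod_others mulr_sumr big_seq [leRHS]big_seq; apply: ler_sum => k ks.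
  apply: ler_wpM2r; last exact: mmax.
  by apply: prodr_ge0 => i _; rewrite ltW.
rewrite (perm_big _ (perm_to_rem ms)) big_cons ler_wpM2r //.
  by apply: prodr_ge0 => i _; rewrite ltW.
have am : a != m by apply: contraNneq as_ => ->.
by have := p_compl am; lra.
Qed.

Lemma prob_lt1 i k : i != k -> p i k < 1.
Proof. by move=> /p_compl ik; have := p_gt0 k i; lra. Qed.

Lemma sum_prod_others_le1 (s : seq T) : uniq s -> sum_prod_others p s <= 1.
Proof.
elim: s => [|a s IH] /=; first by rewrite /sum_prod_others big_nil.
case/andP=> as_ us; have [->|s0] := eqVneq s [::].
  by rewrite /sum_prod_others big_seq1 big_cons eqxx big_nil.
have [m ms /le_trans] := sum_prod_others_argmax as_ s0 (IH us); apply.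
have ma : m != a by apply: contraNneq as_ => <-.
suff : \prod_(i <- rem m s) p a i <= 1 by have := prob_lt1 ma; nra.
rewrite big_seq; apply: prodr_ile1 => i /mem_rem is_; rewrite ltW ?p_gt0 //=.
by rewrite ltW // prob_lt1 //; apply: contraNneq as_ => ->.
Qed.

(** A third player [i] puts a factor [p a i <= 3 / 4] into the product over [rem m s]. As
    [p m a <= 3 / 4] too, the bound is at most 3/4 + 1/4 of 3/4. *)
Lemma sum_prod_others_gap (s : seq T) : uniq s -> (3 <= size s)%N ->
  (forall i k, i \in s -> k \in s -> i != k -> 4^-1 <= p i k) ->
  sum_prod_others p s <= 15 / 16.
Proof.
case: s => [|a s] //= /andP[as_ us]; rewrite ltnS => s2 p4.
have s0 : s != [::] by case: (s) s2.
have [m ms /le_trans] := sum_prod_others_argmax as_ s0 (sum_prod_others_le1 us); apply.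
have ma : m != a by apply: contraNneq as_ => <-.
have pam : 4^-1 <= p a m by rewrite p4 ?mem_head ?inE ?ms ?orbT // eq_sym.
have pma := p_compl ma.
have [i ir] : exists i, i \in rem m s.
  move: (size_rem ms); case: (rem m s) => [|i r _]; last by exists i; rewrite mem_head.
  by move: s2; case: (size s) => [|[]].
have is_ := mem_rem ir.
have ai : i != a by apply: contraNneq as_ => <-.
have pia : 4^-1 <= p i a by rewrite p4 ?mem_head ?inE ?is_ ?orbT.
have pai := p_compl ai.
suff : \prod_(i <- rem m s) p a i <= 3 / 4 by nra.
rewrite (perm_big _ (perm_to_rem ir)) big_cons.
apply: (@le_trans _ _ (p a i)); last by lra.
rewrite ler_piMr ?(ltW (p_gt0 _ _)) //.
rewrite big_seq; apply: prodr_ile1 => k /mem_rem/mem_rem ks; rewrite ltW ?p_gt0 //=.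
by rewrite ltW // prob_lt1 //; apply: contraNneq as_ => ->.
Qed.

End Tournament.

(** * Dynamics of the column sums *)

(* Column sums of [A *m gasket_mx j] in terms of those of [A]. *)
Definition step {V : nmodType} {d} (c : 'I_d -> V) (j k : 'I_d) : V :=
  if k == j then c k else c k + c j.

Lemma step_same {V : nmodType} {d} (c : 'I_d -> V) j : step c j j = c j.
Proof. by rewrite /step eqxx. Qed.

Lemma step_diff {V : nmodType} {d} (c : 'I_d -> V) j k :
  k != j -> step c j k = c k + c j.
Proof. by rewrite /step => /negbTE->. Qed.

Lemma iter_step {V : nmodType} {d} (c : 'I_d -> V) j t k :
  iter t (step^~ j) c k = if k == j then c k else c k + c j *+ t.
Proof.
elim: t k => [|t IH] k /=; first by rewrite mulr0n addr0 if_same.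
by rewrite /step !IH eqxx; case: eqVneq => // _; rewrite mulrSr addrA.
Qed.

Lemma sum_iter_recl {V : nmodType} {T : Type} (F : T -> V) (f : T -> T) x n :
  \sum_(t < n.+1) F (iter t f x) = F x + \sum_(t < n) F (iter t f (f x)).
Proof.
rewrite big_ord_recl; congr (_ + _); apply: eq_bigr => t _.
by rewrite lift0 iterSr.
Qed.

Section States.
Context {R : realFieldType} {d : nat}.
Hypothesis hd : (3 <= d)%N.
Implicit Types (c : 'I_d -> R) (j k m : 'I_d).

(* In the orbit of (1, ..., 1) the deficit [\sum_k c k - (d - 1) * c m] stays
   positive: a step [j] leaves it unchanged unless [j = m], when it becomes the
   full sum. *)
Definition balanced c :=
  (forall k, 0 < c k) /\ (forall m, d.-1%:R * c m <= \sum_k c k).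

(** The state right after the letter changes to [j]; the initial vector of ones qualifies too. The
    factor 3 makes all ratios [c i / (c i + c k)] at least 1/4. *)
Definition switched c j :=
  balanced c /\ forall k, c j <= c k <= 3 * c j.

Lemma step_gt0 c j : (forall k, 0 < c k) -> forall k, 0 < step c j k.
Proof. by move=> c0 k; rewrite /step; case: eqP => _ //; rewrite addr_gt0. Qed.

Lemma iter_step_gt0 c j t : (forall k, 0 < c k) ->
  forall k, 0 < iter t (step^~ j) c k.
Proof. by move=> c0; elim: t => //= t IH; exact: step_gt0. Qed.

Lemma sum_step c j : \sum_k step c j k = \sum_k c k + d.-1%:R * c j.
Proof.
rewrite (bigD1 j) //= [in RHS](bigD1 j) //= step_same -addrA; congr (_ + _).
rewrite (eq_bigr _ (fun k (h : k != j) => step_diff c h)) big_split /=.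
by rewrite sumr_const cardC1 card_ord mulr_natl.
Qed.

Lemma balanced_step c j : balanced c -> balanced (step c j).
Proof.
move=> [c0 cb]; split=> [|m]; first exact: step_gt0.
rewrite sum_step; have [->|mj] := eqVneq m j.
  by rewrite step_same lerDr sumr_ge0 // => k _; exact: ltW.
by rewrite step_diff // mulrDr lerD2r.
Qed.

(** In the balance condition for the largest entry [c M], bounding the entries other than [c a] and
    [c b] by [c M] leaves [c M <= c a + c b]. *)
Lemma balanced_triangle c a b m : balanced c -> a != b -> c m <= c a + c b.
Proof.
move=> [c0 cb] ab.
have [M Mmax] : exists M, forall k, c k <= c M.
  by exists [arg max_(i > a) c i]%O; case: arg_maxP => // i _ h k; exact: h.
apply: le_trans (Mmax m) _; have := cb M.
rewrite (bigD1 a) //= (bigD1 b) 1?eq_sym //= => h.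
have {}h : d.-1%:R * c M <= c a + (c b + d.-2%:R * c M).
  apply: le_trans h _; rewrite !lerD2l.
  apply: (@le_trans _ _ (\sum_(i | (i != a) && (i != b)) c M)).
    exact: ler_sum.
  rewrite sumr_const mulr_natl.
  have -> // : #|[pred i | (i != a) && (i != b)]| = d.-2.
  have -> : #|[pred i | (i != a) && (i != b)]| = #|~: [set a; b]|.
    by apply: eq_card => i; rewrite !inE negb_or.
  by rewrite cardsCs finset.setCK card_ord cards2 ab; case: d hd => [|[|]] //= n _; rewrite subn2.
have e : d.-1%:R = d.-2%:R + 1 :> R by case: d hd => [|[|n]] //= _; rewrite -natr1.
by move: h; rewrite e mulrDl mul1r; lra.
Qed.

(** For [m != k] the new entry [c m + c k] is at most [3 * c k], since
    [c m <= c l + c k <= 2 * c k]. *)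
Lemma switched_step c l k : balanced c -> (forall m, c l <= c m) -> k != l ->
  switched (step c k) k.
Proof.
move=> bc cl kl; split=> [|m]; first exact: balanced_step.
have c0 := bc.1; rewrite step_same; have [->|mk] := eqVneq m k.
  by rewrite step_same; have := c0 k; lra.
rewrite step_diff //; have := c0 m; have := c0 k; have := cl k.
by have := balanced_triangle m bc kl; lra.
Qed.

Lemma balanced_iter c j t : balanced c -> balanced (iter t (step^~ j) c).
Proof. by move=> bc; elim: t => //= t; exact: balanced_step. Qed.

(** Repeating [j] fixes [c j] and enlarges the other entries, so the entry at [j] stays the smallest
    until the letter changes. *)
Lemma switched_iter c j t k : switched c j -> k != j ->
  switched (step (iter t (step^~ j) c) k) k.
Proof.
move=> [bc cj] kj; apply: (@switched_step _ j) => //; first exact: balanced_iter.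
move=> m; rewrite !iter_step eqxx; case: eqVneq => [->//|_].
by have /andP[h _] := cj m; rewrite (le_trans h) // lerDl mulrn_wge0 // ltW // bc.1.
Qed.

Definition vol c : R := (\prod_k c k)^-1.

Lemma vol_gt0 c : (forall k, 0 < c k) -> 0 < vol c.
Proof. by move=> c0; rewrite invr_gt0 prodr_gt0. Qed.

(** The letter [k] multiplies the volume by the chance that [k] wins a tournament where it beats [i]
    with probability [c i / (c i + c k)]. *)
Lemma sum_vol_step c : (forall k, 0 < c k) ->
  \sum_k vol (step c k) =
  vol c * sum_prod_others (fun k i => c i / (c i + c k)) (index_enum 'I_d).
Proof.
move=> c0; rewrite /sum_prod_others mulr_sumr; apply: eq_bigr => k _.
rewrite /vol (bigD1 k) //= [X in X^-1 * _](bigD1 k) //= step_same.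
rewrite !invfM -mulrA; congr (_ * _); rewrite -!prodfV -big_split /=.
apply: eq_bigr => i ik; rewrite step_diff // mulrA mulVf ?mul1r //.
by rewrite gt_eqF.
Qed.

Lemma ratio_gt0 c : (forall k, 0 < c k) -> forall k i, 0 < c i / (c i + c k).
Proof. by move=> c0 k i; rewrite divr_gt0 ?addr_gt0. Qed.

Lemma ratio_compl c : (forall k, 0 < c k) ->
  forall i k, i != k -> c k / (c k + c i) + c i / (c i + c k) = 1.
Proof.
move=> c0 i k _; rewrite [c i + c k]addrC -mulrDl divff //.
by rewrite gt_eqF ?addr_gt0.
Qed.

Lemma sum_vol_step_le c : (forall k, 0 < c k) -> \sum_k vol (step c k) <= vol c.
Proof.
move=> c0; rewrite sum_vol_step // ler_piMr ?(ltW (vol_gt0 c0)) //.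
apply: sum_prod_others_le1; [exact: ratio_gt0|exact: ratio_compl|].
exact: index_enum_uniq.
Qed.

Lemma sum_vol_step_gap c j : switched c j ->
  \sum_k vol (step c k) <= 15 / 16 * vol c.
Proof.
move=> [[c0 _] cj]; rewrite sum_vol_step // mulrC ler_pM2r ?vol_gt0 //.
apply: sum_prod_others_gap; [exact: ratio_gt0|exact: ratio_compl|..].
- exact: index_enum_uniq.
- by rewrite [index_enum _]unlock -enumT size_enum_ord.
move=> i k _ _ _; rewrite ler_pdivlMr ?addr_gt0 //.
have := cj i; have := cj k; have := c0 j; lra.
Qed.

(** The words [j^t k] with [t < T], together with [j^T], label cylinders with disjoint interiors.
    The induction splits off one letter [j] at a time. *)
Lemma sum_vol_blocks_le c j T : (forall k, 0 < c k) ->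
  \sum_(t < T) \sum_(k | k != j) vol (step (iter t (step^~ j) c) k)
    + vol (iter T (step^~ j) c) <= vol c.
Proof.
elim: T c => [|T IH] c c0; first by rewrite big_ord0 add0r.
rewrite (sum_iter_recl (fun x => \sum_(k | k != j) vol (step x k))) iterSr -addrA.
apply: le_trans (sum_vol_step_le c0).
rewrite [leRHS](bigD1 j) //= [leRHS]addrC lerD2l.
exact/IH/step_gt0.
Qed.

(** The gap is gained on the first letter; the later ones do not increase the total volume. *)
Lemma sum_vol_blocks_gap c j T : switched c j ->
  \sum_(t < T) \sum_(k | k != j) vol (step (iter t (step^~ j) c) k)
    <= 15 / 16 * vol c.
Proof.
move=> sc; have c0 := sc.1.1; case: T => [|T].
  by rewrite big_ord0 mulr_ge0 // ltW ?vol_gt0.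
apply: le_trans (sum_vol_step_gap sc).
rewrite (sum_iter_recl (fun x => \sum_(k | k != j) vol (step x k))).
rewrite [leRHS](bigD1 j) //= [leRHS]addrC lerD2l.
apply: le_trans (sum_vol_blocks_le j T (step_gt0 j c0)).
by rewrite lerDl ltW // vol_gt0 //; exact/iter_step_gt0/step_gt0.
Qed.

Lemma vol_le c c' (x : 'I_d -> R) : (forall k, 0 < c k) -> (forall k, 0 < x k) ->
  (forall k, c k * x k <= c' k) -> vol c' <= vol c / \prod_k x k.
Proof.
move=> c0 x0 cc'; rewrite /vol -invfM -big_split /= lef_pV2 ?posrE.
- by apply: ler_prod => k _; rewrite cc' mulr_ge0 // ltW.
- by apply: prodr_gt0 => k _; apply: lt_le_trans (cc' k); rewrite mulr_gt0.
- by apply: prodr_gt0 => k _; rewrite mulr_gt0.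
Qed.

(** The [d - 1 >= 2] entries other than [c j] grow at least by the factor [(t + 1) / 3], because
    [c k <= 3 * c j]. *)
Lemma vol_iter_le c j t : switched c j ->
  vol (iter t (step^~ j) c) <= 3 ^+ d * vol c / t.+1%:R ^+ 2.
Proof.
move=> [[c0 _] cj]; have n0 : 0 < t.+1%:R :> R by [].
pose x k : R := 3^-1 * (if k == j then 1 else t.+1%:R).
apply: (le_trans (@vol_le c _ x c0 _ _)) => [k|k|].
- by rewrite /x; case: eqP => _; rewrite mulr_gt0.
- rewrite iter_step /x; case: eqP => [->|_]; first by have := c0 j; lra.
  rewrite -[c j *+ t]mulr_natr -[t.+1%:R]natr1; have /andP[_ ck] := cj k; have := c0 k.
  have /(ler_wpM2l (ler0n R t)) := ck. lra.
rewrite /x big_split /= prodr_const card_ord exprVn invfM invrK mulrCA mulrA.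
rewrite ler_pM2l ?mulr_gt0 ?exprn_gt0 ?vol_gt0 //.
rewrite (bigD1 j) //= eqxx mul1r.
rewrite (eq_bigr (fun=> t.+1%:R)) => [|i /negbTE->//].
rewrite prodr_const cardC1 card_ord lef_pV2 ?posrE ?exprn_gt0 //.
by rewrite ler_weXn2l ?ler1n // -ltnS prednK //; case: d hd.
Qed.

(** The final letter [k] also enlarges the entry at [j], so all [d >= 3] entries have grown at least
    by the factor [(t + 1) / 3]. The power 3 stays summable after taking square roots. *)
Lemma vol_block_le c j t k : switched c j -> k != j ->
  vol (step (iter t (step^~ j) c) k) <= 3 ^+ d * vol c / t.+1%:R ^+ 3.
Proof.
move=> [[c0 _] cj] kj; have n0 : 0 < t.+1%:R :> R by [].
apply: (le_trans (@vol_le c _ (fun=> 3^-1 * t.+1%:R) c0 _ _)) => [m|m|].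
- by rewrite mulr_gt0.
- rewrite /step !iter_step (negbTE kj) -[c j *+ t]mulr_natr -[t.+1%:R]natr1.
  have /andP[jm mj] := cj m; have /andP[jk kj'] := cj k; have := c0 j.
  have := ler_wpM2l (ler0n R t) mj; have := ler_wpM2l (ler0n R t) kj'.
  have := mulr_ge0 (ler0n R t) (ltW (c0 j)).
  case: (eqVneq m k) => [->|_]; first by rewrite (negbTE kj); lra.
  by case: (eqVneq m j) => [->|_]; lra.
rewrite prodr_const card_ord exprMn exprVn invfM invrK mulrCA mulrA.
rewrite ler_pM2l ?mulr_gt0 ?exprn_gt0 ?vol_gt0 //.
by rewrite lef_pV2 ?posrE ?exprn_gt0 // ler_weXn2l // ler1n.
Qed.

End States.

(** * Convergence of the sum over all words at an exponent below 1 *)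

Section PoincareSeries.
Context {R : realType}.

(* The interpolation between the exponents 1 and 1/2 makes the gap at
   exponent 1 persist at [1 - e]. *)
Lemma powR_interpolation (x e : R) : 0 < x -> 0 < e < 2^-1 ->
  x `^ (1 - e) <= x + 2 * e * Num.sqrt x.
Proof.
move=> x0 /andP[e0 e2].
have p0 : 0 < 1 - 2 * e by lra.
have q0 : 0 < 2 * e by lra.
have pq : 1 - 2 * e + 2 * e = 1 by rewrite subrK.
have := @conjugate_powR R (x `^ (1 - 2 * e)) ((Num.sqrt x) `^ (2 * e))
  (1 - 2 * e)^-1 (2 * e)^-1 (powR_ge0 _ _) (powR_ge0 _ _).
rewrite !invr_gt0 !invrK => /(_ p0 q0 pq).
rewrite -!powRrM !mulfV ?gt_eqF // !powRr1 ?sqrtr_ge0 ?(ltW x0) //.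
rewrite -powR12_sqrt ?(ltW x0) // -powRrM -powRD; last by rewrite (gt_eqF x0) implybT.
have -> : 1 - 2 * e + 2^-1 * (2 * e) = 1 - e by lra.
move/le_trans; apply; rewrite [_ `^ _ * (2 * e)]mulrC lerD2r.
by rewrite ler_piMr ?(ltW x0) //; lra.
Qed.

Lemma sum_inv_sqrt3 T :
  \sum_(t < T) ((Num.sqrt t.+1%:R)^-1 ^+ 3 : R) <= 3.
Proof.
(* Comparison with the integral of [x^(-3/2)], whose tail from [T + 1] is the subtracted term;
   equality holds for a single term. *)
suff : \sum_(t < T.+1) ((Num.sqrt t.+1%:R)^-1 ^+ 3 : R)
    <= 3 - 2 * (Num.sqrt T.+1%:R)^-1.
  rewrite big_ord_recr /= => h.
  have u0 : 0 < (Num.sqrt T.+1%:R)^-1 :> R by rewrite invr_gt0 sqrtr_gt0.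
  have : 0 < (Num.sqrt T.+1%:R)^-1 ^+ 3 :> R by rewrite exprn_gt0.
  lra.
elim: T => [|T IH].
  by rewrite big_ord_recr big_ord0 /= sqrtr1 invr1 expr1n; lra.
rewrite big_ord_recr /=; apply: (le_trans (lerD IH (lexx _))).
have r0 : 0 < Num.sqrt T.+1%:R :> R by rewrite sqrtr_gt0.
have r0' : 0 < Num.sqrt T.+2%:R :> R by rewrite sqrtr_gt0.
have e : Num.sqrt T.+1%:R ^+ 2 = T.+1%:R :> R by rewrite sqr_sqrtr.
have e' : Num.sqrt T.+2%:R ^+ 2 = T.+1%:R + 1 :> R.
  by rewrite sqr_sqrtr // -natr1.
have le : Num.sqrt T.+1%:R <= Num.sqrt T.+2%:R :> R by rewrite ler_sqrt // ler_nat.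
move: (Num.sqrt T.+1%:R) (Num.sqrt T.+2%:R) r0 r0' e e' le => x y x0 y0 e e' le.
suff : y^-1 ^+ 3 <= 2 * (x^-1 - y^-1) by lra.
have -> : x^-1 - y^-1 = (y - x) / (x * y) by field; rewrite !gt_eqF.
have -> : y - x = (y + x)^-1.
  apply/eqP; rewrite -subr_eq0; apply/eqP.
  have : (y - x) * (y + x) = 1 by rewrite -subr_sqr e e'; ring.
  have yx : y + x != 0 by rewrite gt_eqF ?addr_gt0.
  by move=> h; rewrite -[y - x](mulfK yx) h mul1r subrr.
have -> : 2 * ((y + x)^-1 / (x * y)) = ((y + x) * (x * y) / 2)^-1.
  by field; rewrite !gt_eqF ?addr_gt0.
rewrite exprVn lef_pV2 ?posrE ?exprn_gt0 ?divr_gt0 ?mulr_gt0 ?addr_gt0 //.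
have xy : x * y <= y ^+ 2 by rewrite expr2 ler_pM2r.
have := ler_pM (ltW (addr_gt0 y0 x0)) (ltW (mulr_gt0 x0 y0)) (lerD (lexx y) le) xy.
by rewrite exprSr; lra.
Qed.

Context {d : nat}.
Hypothesis hd : (3 <= d)%N.
Implicit Types (c : 'I_d -> R) (j k : 'I_d).

Let K : R := 3 ^+ d.

Let K_ge1 : 1 <= K.
Proof. by rewrite exprn_ege1 // ler1n. Qed.

(** Since [1 - e >= 3 / 4], the decay [(t + 1)^-2] of the volumes becomes at worst
    [(t + 1)^(-3/2)]. *)
Lemma sum_vol_iter_powR c j T (e : R) : switched c j -> 0 < e <= 4^-1 ->
  \sum_(t < T) vol (iter t (step^~ j) c) `^ (1 - e) <= 3 * K * vol c `^ (1 - e).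
Proof.
move=> sc /andP[e0 e4]; have c0 := sc.1.1; have v0 := vol_gt0 c0.
apply: (@le_trans _ _ (\sum_(t < T)
    (Num.sqrt t.+1%:R)^-1 ^+ 3 * (K * vol c `^ (1 - e)))); last first.
  rewrite -mulr_suml -mulrA ler_wpM2r ?sum_inv_sqrt3 //.
  by rewrite mulr_ge0 ?powR_ge0 // exprn_ge0.
apply: ler_sum => t _.
have r1 : 1 <= Num.sqrt t.+1%:R :> R by rewrite -[leLHS]sqrtr1 ler_sqrt // ler1n.
have r0 : 0 < (Num.sqrt t.+1%:R)^-1 :> R by rewrite invr_gt0; lra.
have r1' : (Num.sqrt t.+1%:R)^-1 <= 1 :> R by rewrite invf_le1 //; lra.
apply: (@le_trans _ _ ((K * vol c / t.+1%:R ^+ 2) `^ (1 - e))).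
  apply: ge0_ler_powR; rewrite ?nnegrE; first lra.
  - by rewrite ltW // vol_gt0 //; exact: iter_step_gt0.
  - by rewrite divr_ge0 ?mulr_ge0 ?exprn_ge0 ?ltW.
  - exact: vol_iter_le.
rewrite mulrAC powRM ?divr_ge0 ?exprn_ge0 ?(ltW v0) // mulrA.
rewrite ler_wpM2r ?powR_ge0 // powRM ?exprn_ge0 ?invr_ge0 // mulrC.
apply: ler_pM; rewrite ?powR_ge0 //; last first.
  rewrite -[leRHS]powRr1 ?exprn_ge0 //; apply: ler_powR => //; lra.
have -> : (t.+1%:R ^+ 2)^-1 = (Num.sqrt t.+1%:R)^-1 `^ 4 :> R.
  by rewrite powR_mulrn ?(ltW r0) // exprVn (exprM _ 2 2) sqr_sqrtr.
rewrite -powRrM -powR_mulrn ?(ltW r0) //; apply: ger_powR; first by rewrite r0.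
by lra.
Qed.

(** [powR_interpolation] is applied to the ratios to [vol c]. The linear terms sum to at most 15/16
    by the gap; the square roots, each at most [K * (t + 1)^(-3/2)], yield an error of at most
    [2 * e * d * K * 3]. *)
Lemma sum_vol_block_powR c j T (e : R) : switched c j -> 0 < e <= 4^-1 ->
  \sum_(t < T) \sum_(k | k != j) vol (step (iter t (step^~ j) c) k) `^ (1 - e)
    <= (15 / 16 + 6 * d%:R * K * e) * vol c `^ (1 - e).
Proof.
move=> sc /andP[e0 e4]; have c0 := sc.1.1; have v0 := vol_gt0 c0.
pose v t k := vol (step (iter t (step^~ j) c) k).
have vv0 t k : 0 < v t k by apply/vol_gt0/step_gt0/iter_step_gt0.
apply: (@le_trans _ _ (\sum_(t < T) \sum_(k | k != j)
   (v t k / vol c + 2 * e * (K * (Num.sqrt t.+1%:R)^-1 ^+ 3)) * vol c `^ (1 - e))).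
  apply: ler_sum => t _; apply: ler_sum => k kj; rewrite -/(v t k).
  have {1}-> : v t k = v t k / vol c * vol c by rewrite divfK ?gt_eqF.
  have q0 : 0 < v t k / vol c by rewrite divr_gt0.
  rewrite powRM ?(ltW q0) ?(ltW v0) // ler_wpM2r ?powR_ge0 //.
  apply: le_trans (powR_interpolation q0 _) _; first by lra.
  rewrite lerD2l ler_pM2l; last lra.
  rewrite -[leRHS]ger0_norm ?mulr_ge0 ?exprn_ge0 ?invr_ge0 ?sqrtr_ge0 //.
  rewrite -sqrtr_sqr ler_wsqrtr // ler_pdivrMr //.
  apply: le_trans (vol_block_le hd t sc kj) _.
  rewrite -/K mulrAC ler_pM2r // exprMn -[(_ ^+ 3) ^+ 2]exprM exprVn.
  rewrite [(3 * 2)%N]mulnC exprM sqr_sqrtr //.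
  rewrite ler_wpM2r ?invr_ge0 ?exprn_ge0 // expr2 ler_peMr //.
  by rewrite exprn_ge0.
under eq_bigr do rewrite -mulr_suml big_split /=.
rewrite -mulr_suml ler_wpM2r ?powR_ge0 // big_split /=; apply: lerD.
  under eq_bigr do rewrite -mulr_suml.
  rewrite -mulr_suml ler_pdivrMr //; exact: sum_vol_blocks_gap.
pose n := #|[pred k | k != j]|; have nd : n%:R <= d%:R :> R.
  by rewrite ler_nat -[leqRHS]card_ord max_card.
rewrite (eq_bigr (fun t : 'I_T => n%:R * 2 * e * K * (Num.sqrt t.+1%:R)^-1 ^+ 3)).
  2: by move=> t _; rewrite sumr_const -/n -[LHS]mulr_natl; ring.
rewrite -mulr_sumr.
have a0 : 0 <= e * K by rewrite mulr_ge0 ?exprn_ge0 // ltW.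
apply: (@le_trans _ _ (n%:R * 2 * e * K * 3)).
  by rewrite ler_wpM2l ?sum_inv_sqrt3 // -mulrA mulr_ge0 // mulr_ge0.
have := ler_wpM2r a0 nd; lra.
Qed.

(** The [n]-th term of the Poincaré series: the branches of the recursion are the words of length
    [n]. *)
Fixpoint level (s : R) (n : nat) c : R :=
  if n is n'.+1 then \sum_j level s n' (step c j) else vol c `^ s.

Lemma level_ge0 s n c : 0 <= level s n c.
Proof.
by elim: n c => [|n IH] c /=; [exact: powR_ge0|apply: sumr_ge0].
Qed.

Lemma sum_level_recl s N c : \sum_(n < N.+1) level s n c =
  vol c `^ s + \sum_j \sum_(n < N) level s n (step c j).
Proof.
by rewrite big_ord_recl exchange_big.
Qed.

(** A word is either [j^t] or [j^t k w] with [k != j]. The length of [w] is relaxed to any value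
    below [N]; the separate bound [M] lets the induction run with [N] fixed. *)
Lemma sum_level_unroll s N M c j : (M <= N.+1)%N ->
  \sum_(n < M) level s n c <=
  \sum_(t < M) (vol (iter t (step^~ j) c) `^ s
     + \sum_(k | k != j) \sum_(n < N) level s n (step (iter t (step^~ j) c) k)).
Proof.
elim: M c => [|M IH] c MN; first by rewrite !big_ord0.
rewrite sum_level_recl (sum_iter_recl (fun x => vol x `^ s
   + \sum_(k | k != j) \sum_(n < N) level s n (step x k))).
rewrite (bigD1 j) //= -[leRHS]addrA lerD2l addrC; apply: lerD.
  apply: ler_sum => k _; rewrite -(subnKC (MN : (M <= N)%N)) big_split_ord /=.
  by rewrite lerDl sumr_ge0 // => i _; exact: level_ge0.
exact/IH/ltnW.
Qed.

(** Chosen to make the error [6 * d * K * e] equal to 1/32, hence the contraction factor 31/32. *)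
Definition gap_exp : R := (192 * d%:R * K)^-1.

Lemma gap_exp_itv : 0 < gap_exp <= 4^-1.
Proof.
have d1 : 1 <= d%:R :> R by rewrite ler1n; case: d hd.
have dK : 1 <= d%:R * K by rewrite mulr_ege1.
rewrite /gap_exp -mulrA invr_gt0 lef_pV2 ?posrE; lra.
Qed.

(** A renewal inequality: the words [j^t] contribute [3 * K], and every block ends in a switched
    state, to which the induction hypothesis applies. The constant [x = 96 * K] solves
    [3 * K + 31 / 32 * x = x]. *)
Lemma sum_level_le N c j : switched c j ->
  \sum_(n < N) level (1 - gap_exp) n c <= 96 * K * vol c `^ (1 - gap_exp).
Proof.
elim: N c j => [|N IH] c j sc.
  by rewrite big_ord0 !mulr_ge0 ?powR_ge0 // exprn_ge0.
apply: (le_trans (sum_level_unroll _ c j (leqnn N.+1))).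
rewrite big_split /=.
apply: (@le_trans _ _ (3 * K * vol c `^ (1 - gap_exp) + 96 * K *
    ((15 / 16 + 6 * d%:R * K * gap_exp) * vol c `^ (1 - gap_exp)))).
  apply: lerD; first exact: sum_vol_iter_powR gap_exp_itv.
  have K96 : 0 <= 96 * K by rewrite mulr_ge0 ?exprn_ge0.
  apply: (le_trans _ (ler_wpM2l K96 (sum_vol_block_powR N.+1 sc gap_exp_itv))).
  rewrite mulr_sumr; apply: ler_sum => t _; rewrite mulr_sumr.
  by apply: ler_sum => k kj; apply/IH/switched_iter.
rewrite mulrA -mulrDl ler_wpM2r ?powR_ge0 //.
have -> : 6 * d%:R * K * gap_exp = 32^-1.
  have d0 : d%:R != 0 :> R by rewrite pnatr_eq0; case: d hd.
  rewrite /gap_exp; have : K != 0 by rewrite expf_neq0.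
  by move: K (d%:R : R) d0 => x y y0 x0; field; rewrite x0 y0.
by lra.
Qed.

(** Terms staying above [e] from [n0] on would contradict the uniform bound on the partial sums. *)
Lemma level_small (e : R) n0 : 0 < e ->
  exists2 n, (n0 <= n)%N & level (1 - gap_exp) n (fun=> 1) < e.
Proof.
move=> e0; apply: contrapT => h.
have {}h n : (n0 <= n)%N -> e <= level (1 - gap_exp) n (fun=> 1).
  by move=> n0n; rewrite leNgt; apply/negP => ?; apply: h; exists n.
have sc : switched (fun=> 1 : R) (Ordinal (ltnW (ltnW hd))).
  split=> [|k]; last by rewrite lexx mulr1 ler1n.
  split=> // m; rewrite mulr1 sumr_const card_ord ler_nat; exact: leq_pred.
pose C : R := 96 * K * vol ((fun=> 1) : 'I_d -> R) `^ (1 - gap_exp).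
pose m := (Num.truncn (C / e)).+1.
have : e * m%:R <= C.
  apply: le_trans (sum_level_le (n0 + m) sc); rewrite big_split_ord /=.
  rewrite mulr_natr -[in leLHS](card_ord m) -sumr_const.
  rewrite -[leLHS]add0r lerD ?sumr_ge0 // => [i _|]; first exact: level_ge0.
  by apply: ler_sum => i _; rewrite h // leq_addr.
apply/negP; rewrite -ltNge mulrC -ltr_pdivrMr //; exact: truncnS_gt.
Qed.

End PoincareSeries.

(** * Covering a cylinder *)

Definition gasket_mxZ {d} (j : 'I_d) : 'M[int]_d :=
  \matrix_(i, k) ((i == j) || (i == k))%:R.

Definition gasket_mxZ_inv {d} (j : 'I_d) : 'M[int]_d :=
  \matrix_(i, k) (if i == k then 1 else if i == j then -1 else 0).

Lemma mul_gasket_mxZ {m d} (A : 'M[int]_(m, d)) j i k :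
  (A *m gasket_mxZ j) i k = step (A i) j k.
Proof.
rewrite mxE /step; under eq_bigr do rewrite mxE.
have [->|kj] := eqVneq k j.
  rewrite (bigD1 j) //= eqxx mulr1 big1 ?addr0 // => l lj.
  by rewrite (negbTE lj) mulr0.
rewrite (bigD1 k) //= eqxx orbT mulr1; congr (_ + _).
rewrite (bigD1 j) 1?eq_sym //= eqxx mulr1 big1 ?addr0 // => l /andP[lk lj].
by rewrite (negbTE lk) (negbTE lj) mulr0.
Qed.

Lemma mul_gasket_mxZ_inv {m d} (B : 'M[int]_(d, m)) j k i :
  (gasket_mxZ_inv j *m B) k i =
  if k == j then B j i - \sum_(l | l != j) B l i else B k i.
Proof.
rewrite mxE; under eq_bigr do rewrite mxE.
rewrite (bigD1 k) //= eqxx mul1r; case: eqVneq => [->|kj].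
  rewrite -sumrN; congr (_ + _); apply: eq_bigr => l lj.
  by rewrite eq_sym (negbTE lj) mulN1r.
rewrite big1 ?addr0 // => l lk.
by rewrite eq_sym (negbTE lk) mul0r.
Qed.

Lemma gasket_mxZ_invK {d} (j : 'I_d) : gasket_mxZ j *m gasket_mxZ_inv j = 1%:M.
Proof.
apply/mulmx1C/matrixP => k i; rewrite mul_gasket_mxZ_inv !mxE eqxx /=.
case: eqVneq => [->|kj] /=; last by [].
rewrite (eq_bigr (fun l => (l == i)%:R)); last first.
  by move=> l lj; rewrite mxE (negbTE lj).
have [->|ij] := eqVneq j i.
  by rewrite big1 ?subr0 // => l /negbTE->.
rewrite (bigD1 i) 1?eq_sym //= eqxx big1 ?addr0 ?subrr // => l /andP[_ /negbTE->].
by [].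
Qed.

(* By Cramer's rule [B k i] is, up to sign, the determinant of [A] with its [k]-th column
   replaced by a basis vector; this is where the bound on [B] comes from. *)
Definition unimodular {d} (A : 'M[int]_d) (c : 'I_d -> nat) : Prop :=
  [/\ forall k, (0 < c k)%N, forall k, \sum_i A i k = (c k)%:R
    & exists2 B, A *m B = 1%:M
      & forall k i, `|B k i| <= \prod_(m | m != k) (c m)%:R].

Lemma unimodular1 {d} : @unimodular d 1%:M (fun=> 1%N).
Proof.
split=> // [k|].
  rewrite (bigD1 k) //= mxE eqxx big1 ?addr0 // => i /negbTE ik.
  by rewrite mxE ik.
exists 1%:M; first by rewrite mulmx1.
by move=> k i; rewrite mxE big1 //; case: eqP.
Qed.

(** Only row [j] of the inverse changes: the other rows are subtracted from it. The bounds on these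
    rows add up to the terms of degree at most 1 in [c j] of the product of the [c m + c j] over
    [m != j], whence [ler_prodD]. *)
Lemma unimodular_step {d} (A : 'M[int]_d) c j : unimodular A c ->
  unimodular (A *m gasket_mxZ j) (step c j).
Proof.
move=> [c0 Ac [B AB Bc]]; split=> [k|k|].
- by rewrite /step; case: eqP => // _; rewrite ltn_addr.
- under eq_bigr do rewrite mul_gasket_mxZ /step.
  rewrite /step; case: eqP => [_|_]; first exact: Ac.
  by rewrite big_split /= !Ac natrD.
exists (gasket_mxZ_inv j *m B).
  by rewrite mulmxA -(mulmxA A) gasket_mxZ_invK mulmx1.
move=> k i; rewrite mul_gasket_mxZ_inv; case: eqVneq => [->|kj]; last first.
  apply: le_trans (Bc k i) _; apply: ler_prod => m _.
  rewrite ler0n /step ler_nat /=; case: eqP => // _; exact: leq_addr.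
rewrite [leRHS](eq_bigr (fun m => (c m)%:R + (c j)%:R)); last first.
  by move=> m mj; rewrite step_diff // natrD.
apply: le_trans (ler_normB _ _) _.
have := @ler_prodD int _ (fun m => (c m)%:R) (c j)%:R
  [seq m <- index_enum 'I_d | m != j] (fun=> ler0n _ _) (ler0n _ _)
  (filter_uniq _ (index_enum_uniq _)).
rewrite !big_filter; apply: le_trans; apply: lerD; first exact: Bc.
apply: le_trans (ler_norm_sum _ _ _) _.
rewrite /sum_prod_others big_filter mulr_sumr; apply: ler_sum => m mj.
apply: le_trans (Bc m i) _; rewrite (bigD1 j) 1?eq_sym //= big_filter_cond.
by rewrite ler_pM2l ?ltr0n //; under [leLHS]eq_bigl do rewrite andbC.
Qed.

Lemma card_dffun_ord d (h : 'I_d -> nat) :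
  #|{dffun forall k : 'I_d, 'I_(h k)}| = (\prod_k h k)%N.
Proof.
rewrite card_dep_ffun foldrE big_map big_enum /=.
by apply: eq_bigr => k _; rewrite card_ord.
Qed.

Lemma pigeonhole_level (T : finType) (f : T -> nat) (a P : nat) : (0 < P)%N ->
  exists2 q : 'I_P, True & (#|[set x | f x == a + q]%N| * P <= #|T|)%N.
Proof.
move=> P0; pose N (q : 'I_P) := #|[set x | f x == a + q]%N|.
have [q qmin] : exists q, forall r, (N q <= N r)%N.
  by exists [arg min_(r < Ordinal P0) N r]%N; case: arg_minnP => // q _ h r; exact: h.
exists q => //; rewrite -/(N q).
apply: (@leq_trans (\sum_(r < P) N r)%N).
  by rewrite mulnC -[X in (X * _)%N]card_ord -sum_nat_const leq_sum.
rewrite /N; under eq_bigr do rewrite -sum1_card big_mkcond /=.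
rewrite exchange_big /= -sum1_card; apply: leq_sum => x _.
case: (pickP (fun r : 'I_P => x \in [set x | f x == a + r]%N)) => [r xr|h]; last first.
  by rewrite big1 // => r _; rewrite h.
rewrite (bigD1 r) //= xr big1 // => s sr.
case: ifP => //; rewrite !inE in xr * => /eqP xs; move: sr.
by rewrite -(inj_eq val_inj) /= -(eqn_add2l a) -xs xr.
Qed.

Section ConeCover.
Context {R : realType} {d : nat}.
Hypothesis d_gt0 : (0 < d)%N.

Definition realmx {m n} (A : 'M[int]_(m, n)) : 'M[R]_(m, n) := map_mx intr A.

(** All coordinates but one are rounded down; the last one absorbs the errors, each at most 1. *)
Lemma round_sum (p : 'I_d -> R) (Q : int) : \sum_i p i = Q%:~R ->
  exists2 z : 'I_d -> int, \sum_i z i = Q & forall i, `|(z i)%:~R - p i| <= d%:R.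
Proof.
move=> pQ; have [i0] : inhabited 'I_d by exists; exact: Ordinal d_gt0.
pose f i := Num.floor (p i).
have fp i : `|(f i)%:~R - p i| <= 1.
  have /andP[] := floor_itv (p i); rewrite -/(f i) intrD => h1 h2.
  by rewrite ler_norml; apply/andP; split; lra.
exists (fun i => if i == i0 then Q - \sum_(k | k != i0) f k else f i).
  rewrite (bigD1 i0) //= eqxx.
  by rewrite [X in _ + X](eq_bigr f) ?subrK // => i /negbTE->.
move=> i; case: eqP => [->|_]; last first.
  by apply: le_trans (fp i) _; rewrite ler1n.
rewrite intrB -pQ (bigD1 i0) //= rmorph_sum /= addrAC [p i0 + _]addrC addrK.
rewrite -sumrB; apply: le_trans (ler_norm_sum _ _ _) _.
apply: (@le_trans _ _ (\sum_(k | k != i0) 1)).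
  by apply: ler_sum => k _; rewrite distrC.
by rewrite sumr_const ler_nat -[leqRHS]card_ord max_card.
Qed.

Lemma sum_mulmx (A : 'M[int]_d) c (v : 'cV[R]_d) : unimodular A c ->
  \sum_i (realmx A *m v) i 0 = \sum_k (c k)%:R * v k 0.
Proof.
move=> [_ Ac _]; under eq_bigr do rewrite mxE.
rewrite exchange_big /=; apply: eq_bigr => k _; rewrite -mulr_suml.
congr (_ * _); under eq_bigr do rewrite mxE.
by rewrite -rmorph_sum /= Ac rmorph_nat.
Qed.

(* Round [(P + q) *: y + A u], for a suitable integer vector [u], to an integer vector [z]
   of prescribed sum: [B z] is then a nonnegative integer vector, and the number of
   these is controlled, for one of the [P] possible values of the sum, by pigeonhole. *)
Lemma cone_cover A c : unimodular A c ->
  exists L : seq 'cV[R]_d,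
    (size L * (\prod_k c k) ^ 2 <= (d ^ 3 + 3) ^ d * (\prod_k c k) ^ d)%N /\
    forall t : 'cV[R]_d, (forall k, 0 <= t k 0) ->
      \sum_i (realmx A *m t) i 0 = 1 ->
      exists2 z, z \in L &
        forall i, `|(realmx A *m t) i 0 - z i 0| <= d%:R / (\prod_k c k)%:R.
Proof.
move=> uA; have [c0 Ac [B AB Bc]] := uA; have BA := mulmx1C AB.
set P := (\prod_k c k)%N; pose H k := (\prod_(m | m != k) c m)%N.
have HP k : (c k * H k)%N = P by rewrite /P (bigD1 k).
have P0 : (0 < P)%N by rewrite prodn_gt0.
(* If [n >= 0] and [\sum_k c k * n k < (d ^ 3 + 2) * P], then [n k <= (d ^ 3 + 2) * H k], since
   [P = c k * H k]. *)
pose box := {dffun forall k : 'I_d, 'I_((d ^ 3 + 2) * H k).+1}.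
pose dot (n : box) := (\sum_k c k * n k)%N.
have [q _ qbox] := pigeonhole_level dot ((1 + d ^ 3) * P) P0.
set S := [set n | _]%N in qbox.
pose r : R := (P + q)%:R.
have r0 : 0 < r by rewrite ltr0n addn_gt0 P0.
(* [B] turns rounding errors of at most [d] into errors of at most [d ^ 2 * H k], which [u]
   compensates. The entries of [A u] sum to [d ^ 3 * P], whence the [d ^ 3] in the prescribed
   sum. *)
pose u : 'cV[R]_d := \col_k (d ^ 2 * H k)%:R.
pose center (n : box) : 'cV[R]_d := r^-1 *: (realmx A *m (\col_k (n k)%:R - u)).
exists [seq center n | n in S]; split.
  rewrite size_image -[(_ ^ 2)%N]mulnn mulnA.
  apply: (leq_trans (leq_mul qbox (leqnn P))).
  rewrite card_dffun_ord.
  have -> : (P ^ d = (\prod_k H k) * P)%N.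
    rewrite -[in LHS](card_ord d) -prod_nat_const.
    by under eq_bigr => k _ do rewrite -(HP k); rewrite big_split mulnC.
  rewrite mulnA leq_mul2r; apply/orP; right.
  have -> : ((d ^ 3 + 3) ^ d = \prod_(k < d) (d ^ 3 + 3))%N.
    by rewrite prod_nat_const card_ord.
  rewrite -big_split /=.
  apply: leq_prod => k _.
  have : (0 < H k)%N by rewrite prodn_gt0.
  by move: (H k) (d ^ 3)%N => h m; rewrite !mulnDl; lia.
move=> t t0 y1; set y := realmx A *m t in y1 *.
pose p : 'cV[R]_d := r *: y + realmx A *m u.
have psum : \sum_i p i 0 = ((1 + d ^ 3) * P + q)%N%:Z%:~R.
  under eq_bigr do rewrite mxE mxE.
  rewrite big_split /= -mulr_sumr y1 mulr1 (sum_mulmx _ uA).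
  under eq_bigr do rewrite mxE -natrM mulnCA HP.
  rewrite sumr_const card_ord -[_ *+ d]mulr_natr -natrM -natrD -pmulrn.
  by congr (_%:R); rewrite !expnS; lia.
have [z zsum zp] := round_sum psum.
pose zv : 'cV[int]_d := \col_i z i; pose n := B *m zv.
have An : A *m n = zv by rewrite mulmxA AB mul1mx.
have ngeE k : (n k 0)%:~R = r * t k 0 + (d ^ 2 * H k)%:R
    + \sum_i (B k i)%:~R * ((z i)%:~R - p i 0).
  have -> : \sum_i (B k i)%:~R * ((z i)%:~R - p i 0) =
      (realmx B *m (realmx zv - p)) k 0.
    by rewrite mxE; apply: eq_bigr => i _; rewrite !mxE.
  have -> : realmx zv - p = realmx A *m (realmx n - r *: t - u).
    by rewrite !mulmxBr -map_mxM An -scalemxAr /p opprD addrA.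
  by rewrite mulmxA -map_mxM BA map_mx1 mul1mx !mxE; ring.
have n0 k : 0 <= n k 0.
  rewrite -(ler0z R) ngeE; set e := \sum_i _.
  suff : `|e| <= (d ^ 2 * H k)%:R.
    by rewrite ler_norml => /andP[e1 _]; have := mulr_ge0 (ltW r0) (t0 k); lra.
  apply: le_trans (ler_norm_sum _ _ _) _.
  apply: (@le_trans _ _ (\sum_(i < d) (H k)%:R * d%:R)).
    apply: ler_sum => i _; rewrite normrM ler_pM //.
    rewrite -intr_norm pmulrn ler_int; apply: le_trans (Bc k i) _.
    by rewrite -natr_prod natz.
  by rewrite sumr_const card_ord -[_ *+ d]mulr_natr -!natrM ler_nat expnS; lia.
have nsum : \sum_k (c k)%:R * n k 0 = ((1 + d ^ 3) * P + q)%:R.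
  transitivity (\sum_i (A *m n) i 0); last first.
    by rewrite An natz -zsum; apply: eq_bigr => i _; rewrite mxE.
  under [RHS]eq_bigr do rewrite mxE.
  by rewrite exchange_big; apply: eq_bigr => k _; rewrite -mulr_suml Ac.
have absn k : `|n k 0%R|%N%:R = n k 0 by rewrite natz gez0_abs.
have nle k : (`|n k 0%R| < ((d ^ 3 + 2) * H k).+1)%N.
  rewrite ltnS -(leq_pmul2l (c0 k)) mulnCA HP.
  have : (c k * `|n k 0%R| <= (1 + d ^ 3) * P + q)%N.
    rewrite -(ler_nat int) -nsum (bigD1 k) //= natrM absn lerDl.
    by apply: sumr_ge0 => i _; rewrite mulr_ge0.
  by have := ltn_ord q; lia.
pose nb : box := [ffun k => Ordinal (nle k)].
have nbE : \col_k (nb k)%:R = realmx n :> 'cV[R]_d.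
  by apply/matrixP => k l; rewrite (ord1 l) [LHS]mxE [RHS]mxE -absn ffunE rmorph_nat.
exists (center nb).
  apply: fintype.image_f; rewrite inE /dot; apply/eqP.
  apply/eqP; rewrite -(eqr_nat int) -nsum natr_sum; apply/eqP.
  by apply: eq_bigr => k _; rewrite natrM ffunE absn.
move=> i.
have key (y' w z' : 'cV[R]_d) :
    y' i 0 - (r^-1 *: (z' - w)) i 0 = r^-1 * ((r *: y' + w) i 0 - z' i 0).
  by rewrite !mxE; field; rewrite -natrD gt_eqF.
rewrite /center nbE mulmxBr -map_mxM An key -/p.
rewrite normrM gtr0_norm ?invr_gt0 // mulrC; apply: ler_pM; rewrite ?invr_ge0 ?(ltW r0) //.
  by rewrite distrC; have := zp i; rewrite !mxE.
by rewrite lef_pV2 ?posrE // ?ltr0n // /r ler_nat leq_addr.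
Qed.

End ConeCover.

(** * Hausdorff dimension and finite covers *)

Section FiniteCovers.
Context {R : realType} {X : Type}.
Variable dist : X -> X -> R.
Hypothesis dist_xx : forall x, dist x x = 0.

(** Each set carries a real bound on its diameter: the sums stay real, and the diameter [-oo] of an
    empty set does no harm. *)
Definition finite_cover (s delta : R) (A : set X) (e : R) : Prop :=
  exists U : seq (set X * R),
    [/\ A `<=` \bigcup_(p in [set` U]) p.1,
        forall p, p \in U -> 0 <= p.2 <= delta /\ (diam dist p.1 <= p.2%:E)%E
      & \sum_(p <- U) p.2 `^ s <= e].

Lemma diam_ge0 (A : set X) : A != set0 -> (0 <= diam dist A)%E.
Proof.
move=> /set0P[x Ax]; apply: le_ereal_sup_tmp; exists (dist x x)%:E.
  by exists x => //; exists x.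
by rewrite dist_xx.
Qed.

Lemma diam_set0 : diam dist set0 = -oo%E.
Proof.
rewrite /diam (_ : [set _ | _ in _ & _ in _] = set0) ?ereal_sup0 //.
by apply/seteqP; split => // y [].
Qed.

Lemma finite_cover_subset s delta delta' (A A' : set X) e e' :
  A' `<=` A -> delta <= delta' -> e <= e' ->
  finite_cover s delta A e -> finite_cover s delta' A' e'.
Proof.
move=> AA dd ee [U [AU Ud Ue]]; exists U; split.
- exact: subset_trans AU.
- move=> p /Ud[/andP[p0 pd] ?]; split=> //; rewrite p0 /=; exact: le_trans dd.
- exact: le_trans ee.
Qed.

Lemma finite_cover_bigcup (I : eqType) (r : seq I) s delta (A : I -> set X) (e : I -> R) :
  (forall i, finite_cover s delta (A i) (e i)) ->
  finite_cover s delta (\bigcup_(i in [set` r]) A i) (\sum_(i <- r) e i).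
Proof.
move=> Ae; elim: r => [|i r [U [AU Ud Ue]]].
  exists [::]; split=> [x [i]|p|]; rewrite ?in_nil ?big_nil //.
have [V [AV Vd Ve]] := Ae i; exists (V ++ U); split.
- move=> x [k]; rewrite /= inE => /predU1P[->|kr] xk.
    by have [p pV xp] := AV x xk; exists p => //=; rewrite mem_cat pV.
  have [|p pU xp] := AU x; first by exists k.
  by exists p => //=; rewrite mem_cat pU orbT.
- by move=> p; rewrite mem_cat => /orP[/Vd|/Ud].
- by rewrite big_cat big_cons lerD.
Qed.

Lemma hausdorff_premeasure_le s delta (A : set X) e : 0 < s ->
  finite_cover s delta A e -> (hausdorff_premeasure dist s delta A <= e%:E)%E.
Proof.
move=> s0 [U [AU Ud Ue]].
(* The list is padded with empty sets, which the premeasure leaves out; since [s > 0], their bound 0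
   also contributes 0. *)
pose u k := nth (set0, 0) U k.
have ud k : (u k).1 != set0 -> 0 <= (u k).2 /\ (diam dist (u k).1 <= (u k).2%:E)%E.
  have [kU _|Uk] := ltnP k (size U); last by rewrite /u nth_default // eqxx.
  by have [/andP[? _] ?] := Ud _ (mem_nth (set0, 0) kU).
apply: ge_ereal_inf.
exists (\sum_(0 <= k <oo | (u k).1 != set0) (diam dist (u k).1 `^ s)%E)%E.
  exists (fun k => (u k).1) => //; split=> [x /AU[p pU xp]|k].
    by exists (index p U) => //; rewrite /u nth_index.
  have [kU|Uk] := ltnP k (size U); last first.
    by rewrite /u nth_default //= diam_set0 leNye.
  have [/andP[_ h1] h2] := Ud _ (mem_nth (set0, 0) kU).
  by apply: le_trans h2 _; rewrite lee_fin.
apply: lime_le; first by apply: is_cvg_nneseries => k _ _; exact: poweR_ge0.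
apply: nearW => n.
apply: (@le_trans _ _ (\sum_(0 <= k < n) ((u k).2 `^ s)%:E)%E).
  rewrite big_mkcond /=; apply: lee_sum => k _; case: ifPn => [uk|_]; last first.
    by rewrite lee_fin powR_ge0.
  have [u0 du] := ud k uk; rewrite -poweR_EFin; apply: gt0_ler_poweR => //.
  - exact: ltW.
  - by rewrite in_itv /= diam_ge0 // leey.
  - by rewrite in_itv /= lee_fin u0 leey.
rewrite sumEFin lee_fin; apply: le_trans Ue.
rewrite (big_nth (set0, 0)).
apply: (@le_trans _ _ (\sum_(0 <= k < size U + n) (u k).2 `^ s)).
  rewrite [leRHS](big_cat_nat _ (leq_addl (size U) n)) //= lerDl.
  by apply: sumr_ge0 => k _; exact: powR_ge0.
rewrite (big_cat_nat _ (leq_addr n (size U))) //= [X in _ + X]big_nat_cond.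
rewrite [X in _ + X]big1 ?addr0 // => k /andP[/andP[Uk _] _].
by rewrite /u nth_default //= powR0 // gt_eqF.
Qed.

Lemma hausdorff_premeasure_ge0 s delta (A : set X) :
  (0 <= hausdorff_premeasure dist s delta A)%E.
Proof.
apply: le_ereal_inf_tmp => _ [U _ <-]; apply: nneseries_ge0 => k _ _.
exact: poweR_ge0.
Qed.

Lemma hausdorff_dim_le s (A : set X) : 0 < s ->
  (forall delta e, 0 < delta -> 0 < e -> finite_cover s delta A e) ->
  (hausdorff_dim dist A <= s%:E)%E.
Proof.
move=> s0 cov; apply: ge_ereal_inf; exists s%:E => //; exists s => //.
split; first exact: ltW.
apply/eqP; rewrite eq_le; apply/andP; split.
  apply: ge_ereal_sup => _ [delta d0 <-]; apply/lee_addgt0Pr => e e0.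
  by rewrite add0e; apply: hausdorff_premeasure_le => //; exact: cov.
apply: le_ereal_sup_tmp; exists (hausdorff_premeasure dist s 1 A).
  by exists 1 => //=.
exact: hausdorff_premeasure_ge0.
Qed.

End FiniteCovers.

(** * Covers of the gasket by cylinders *)

Section Gasket.
Context {R : realType} {d : nat}.
Hypothesis hd : (3 <= d)%N.
Variable G : set 'cV[R]_d.
Hypothesis hG : is_gasket G.

(** This is [T_w(G)] when [A] is the matrix product of the word [w]; the scalar [l] absorbs the
    normalisations of the maps. *)
Definition cylinder (A : 'M[int]_d) : set 'cV[R]_d :=
  [set y : 'cV[R]_d | \sum_i y i 0 = 1 /\
    exists g (l : R), [/\ G g, 0 <= l & y = l *: (realmx A *m g)]].

Lemma realmx_gasket_mxZ (j : 'I_d) : realmx (gasket_mxZ j) = gasket_mx j :> 'M[R]_d.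
Proof. by apply/matrixP => i k; rewrite !mxE rmorph_nat. Qed.

Lemma gasket_ge0 g : G g -> forall k, 0 <= g k 0.
Proof. by case: hG => _ _ + _ => /[apply] -[g01 _] k; case/andP: (g01 k). Qed.

Lemma gasket_cylinder : G `<=` cylinder 1%:M.
Proof.
move=> g Gg; split.
  case: hG => _ _ /(_ _ Gg)[_ <-] _.
  by apply: eq_bigr => i _; rewrite ger0_norm // gasket_ge0.
by exists g, 1; split=> //; rewrite /realmx map_mx1 mul1mx scale1r.
Qed.

Lemma cylinder_step A :
  cylinder A `<=` \bigcup_(j in [set` enum 'I_d]) cylinder (A *m gasket_mxZ j).
Proof.
move=> y [y1 [g [l [Gg l0 yE]]]]; case: hG => _ _ _ GE.
move: Gg; rewrite {1}GE => -[j _ [g' Gg' gE]].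
exists j; first by rewrite /= mem_enum.
split=> //; exists g', (l * (l1norm (gasket_mx j *m g'))^-1); split=> //.
  by rewrite mulr_ge0 // invr_ge0; apply: sumr_ge0.
rewrite yE -gE /gasket_map -scalemxAr scalerA mulmxA.
by rewrite -realmx_gasket_mxZ -map_mxM.
Qed.

Lemma euclid_dist_xx (x : 'cV[R]_d) : euclid_dist x x = 0.
Proof.
rewrite /euclid_dist big1 ?sqrtr0 // => i _.
by rewrite subrr expr0n.
Qed.

Lemma diam_box (z : 'cV[R]_d) (r : R) : 0 <= r ->
  (diam euclid_dist [set y : 'cV[R]_d | forall i, (`|y i 0 - z i 0| <= r)%R]
     <= (2 * d%:R * r)%:E)%E.
Proof.
move=> r0; apply: ge_ereal_sup => _ [x xz [y yz <-]]; rewrite lee_fin.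
have b0 : 0 <= 2 * d%:R * r by rewrite !mulr_ge0.
rewrite /euclid_dist -[leRHS]ger0_norm // -sqrtr_sqr ler_wsqrtr //.
apply: (@le_trans _ _ (\sum_(i < d) (2 * r) ^+ 2)).
  apply: ler_sum => i _; rewrite -real_normK ?num_real // ler_pXn2r ?nnegrE ?mulr_ge0 //.
  rewrite -[x i 0](subrK (z i 0)) -addrA.
  by apply: le_trans (ler_normD _ _) _; rewrite mulrDl mul1r lerD // distrC.
rewrite sumr_const card_ord -[leLHS]mulr_natr.
have d1 : 1 <= d%:R :> R by rewrite ler1n; case: d hd.
have -> : (2 * d%:R * r) ^+ 2 = (2 * r) ^+ 2 * (d%:R * d%:R) by ring.
by rewrite ler_wpM2l ?exprn_ge0 ?mulr_ge0 // ler_peMr.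
Qed.

Lemma prod_step_gt (c : 'I_d -> nat) j : (forall k, (0 < c k)%N) ->
  (\prod_k c k < \prod_k step c j k)%N.
Proof.
move=> c0; have /card_gt0P[k kj] : (0 < #|predC1 j|)%N.
  by rewrite cardC1 card_ord -subn1 subn_gt0 (ltnW hd).
rewrite inE in kj.
have le m : (c m <= step c j m)%N by rewrite /step; case: eqP => // _; exact: leq_addr.
rewrite (bigD1 k) //= [ltnRHS](bigD1 k) //=.
apply: (@leq_trans (step c j k * \prod_(i | i != k) c i)).
  rewrite ltn_pmul2r ?prodn_gt0 // step_diff // -[ltnLHS]addn0.
  by rewrite (ltn_add2l (c k) 0 (c j)).
by rewrite leq_mul2l leq_prod ?orbT.
Qed.

Let e : R := @gap_exp R d.
Let s : R := d%:R - 1 - e.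
Let C : R := ((d ^ 3 + 3) ^ d)%:R * (2 * d%:R ^+ 2) `^ s.

Lemma cylinder_cover_base A c P0 : unimodular A c -> (P0 <= \prod_k c k)%N -> (0 < P0)%N ->
  finite_cover euclid_dist s (2 * d%:R ^+ 2 / P0%:R) (cylinder A)
    (C * vol (fun k => (c k)%:R) `^ (1 - e)).
Proof.
move=> uA P0c P00; have [c0 _ _] := uA.
have d0 : (0 < d)%N by case: d hd.
have [L [sizeL Lcov]] := cone_cover (R := R) d0 uA.
move: sizeL Lcov P0c; rewrite /vol -natr_prod; set P := (\prod_k c k)%N => sizeL Lcov P0c.
have P_gt0 : 0 < P%:R :> R by rewrite ltr0n (leq_trans P00).
pose box (z : 'cV[R]_d) :=
  ([set y : 'cV[R]_d | forall i, (`|y i 0 - z i 0| <= d%:R / P%:R)%R],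
   2 * d%:R ^+ 2 / P%:R : R).
exists [seq box z | z <- L]; split.
- move=> y [y1 [g [l [Gg l0 yE]]]].
  have yE' : y = realmx A *m (l *: g) by rewrite yE scalemxAr.
  have [||z zL yz] := Lcov (l *: g).
  + by move=> k; rewrite mxE mulr_ge0 // gasket_ge0.
  + by rewrite -yE'.
  exists (box z); first by rewrite /=; apply: map_f.
  by rewrite yE' /=.
- move=> _ /mapP[z zL ->] /=; split.
    rewrite mulr_ge0 ?invr_ge0 ?mulr_ge0 ?exprn_ge0 //=.
    rewrite ler_wpM2l ?mulr_ge0 ?exprn_ge0 // lef_pV2 ?posrE ?ltr0n //.
      by rewrite ler_nat.
    by rewrite (leq_trans P00).
  have -> : 2 * d%:R ^+ 2 / P%:R = 2 * d%:R * (d%:R / P%:R) :> R by ring.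
  exact/diam_box/divr_ge0.
rewrite /box big_map /= big_const_seq count_predT iter_addr_0 -[_ *+ size L]mulr_natl.
rewrite powRM ?invr_ge0 ?mulr_ge0 ?exprn_ge0 // /C.
rewrite mulrCA [leLHS]mulrC [leRHS]mulrAC.
rewrite ler_wpM2r ?powR_ge0 //.
(* The part [d - 2] of the exponent cancels the number of sets; [1 - e] remains. *)
have sE : s = (d - 2)%:R + (1 - e).
  by rewrite natrB ?(ltnW hd) // /s; ring.
have x0 : 0 < P%:R^-1 :> R by rewrite invr_gt0.
rewrite sE powRD; last by rewrite (gt_eqF x0) implybT.
rewrite powR_mulrn ?(ltW x0) // mulrA ler_wpM2r ?powR_ge0 //.
rewrite -(ler_pM2r (exprn_gt0 d P_gt0)).
have -> : (size L)%:R * P%:R^-1 ^+ (d - 2) * P%:R ^+ d = (size L * P ^ 2)%:R :> R.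
  rewrite -mulrA natrM natrX; congr (_ * _).
  rewrite -[in _ ^+ d](subnK (ltnW hd)) exprD mulrA -exprMn mulVf ?gt_eqF //.
  by rewrite expr1n mul1r.
by rewrite -natrX -natrM ler_nat.
Qed.

(** Each of the [n] letters still to come adds at least 1 to the integer product of column sums,
    which therefore ends at [P0] or above; this controls the mesh. *)
Lemma cylinder_cover n A c P0 : unimodular A c -> (P0 <= \prod_k c k + n)%N -> (0 < P0)%N ->
  finite_cover euclid_dist s (2 * d%:R ^+ 2 / P0%:R) (cylinder A)
    (C * level (1 - e) n (fun k => (c k)%:R)).
Proof.
elim: n A c => [|n IH] A c uA P0c P00.
  by apply: cylinder_cover_base; rewrite // -[leqRHS]addn0.
have [c0 _ _] := uA.
apply: (finite_cover_subset (cylinder_step (A := A)) (lexx _) (lexx _)).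
rewrite /= mulr_sumr -big_enum /=; apply: finite_cover_bigcup => j.
have -> : step (fun k => (c k)%:R) j = (fun k => (step c j k)%:R) :> ('I_d -> R).
  by apply/funext => k; rewrite /step; case: eqP => // _; rewrite natrD.
apply: IH => //; first exact: unimodular_step.
apply: (leq_trans P0c); rewrite addnS -addSn leq_add2r; exact: prod_step_gt.
Qed.

Lemma gasket_cover delta eps : 0 < delta -> 0 < eps ->
  finite_cover euclid_dist s delta G eps.
Proof.
move=> delta0 eps0.
have C0 : 0 < C.
  rewrite mulr_gt0 ?powR_gt0 ?ltr0n ?expn_gt0 ?addn3 //.
  by rewrite mulr_gt0 // exprn_gt0 // ltr0n; case: d hd.
(* This gives [2 * d ^ 2 / P0 < delta]; words of length at least [P0] have a product of column sums
   at least [P0]. *)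
pose P0 := (Num.truncn (2 * d%:R ^+ 2 / delta)).+1.
have [n P0n ln] := @level_small R d hd (eps / C) P0 (divr_gt0 eps0 C0).
have cov := @cylinder_cover n _ _ P0 unimodular1.
apply: finite_cover_subset (cov _ _).
- exact: gasket_cylinder.
- by rewrite ler_pdivrMr // [leRHS]mulrC -ler_pdivrMr // ltW //; exact: truncnS_gt.
- by rewrite mulrC -ler_pdivlMr // ltW.
- by rewrite (leq_trans P0n) // leq_addl.
- by [].
Qed.

End Gasket.

Theorem theorem1p1 (R : realType) (d : nat) (hd : (3 <= d)%N)
    (G : set 'cV[R]_d) (hG : is_gasket G) :
  (hausdorff_dim euclid_dist G < (d%:R - 1)%:E)%E.
Proof.
have /andP[e0 e4] := @gap_exp_itv R d hd.
apply: (@le_lt_trans _ _ (d%:R - 1 - @gap_exp R d)%:E); last first.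
  by rewrite lte_fin ltrBlDr ltrDl.
apply: hausdorff_dim_le; first exact: euclid_dist_xx.
  have d3 : 3 <= d%:R :> R by rewrite ler_nat.
  by lra.
move=> delta eps; exact: gasket_cover.
Qed.
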